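(* Let $F\in\mathcal S^*$ and let $H\in\mathcal H_b$, where $b\in(0,\infty)$. Let $G_H$ be the distribution on ${\bf R}^+=[0,\infty)$ with tail $$\overline G_H(x)=\min\Biggl(1,\int_0^\infty\overline F(x+t)\,H(dt)\Biggr),\quad x\ge 0 .$$ Then $G_H$ is subexponential. Moreover, $$\overline{G_H*G_H}(x)\sim 2\,\overline G_H(x)$$ as $x\to\infty$ uniformly in $H\in\mathcal H_b$.
   Context: For a distribution $G$, $\overline G(x)=G((x,\infty))$; $*$ denotes convolution; $f\sim g$ means $f/g\to 1$, and ''uniformly in $H\in\mathcal H_b$'' means $\sup_{H\in\mathcal H_b}\bigl|\overline{G_H*G_H}(x)/\overline G_H(x)-2\bigr|\to0$ as $x\to\infty$. Integrals $\int_0^\infty\cdots H(dt)$ are over $[0,\infty)$, including a possible atom at $0$. A distribution $G$ on ${\bf R}^+$ with unbounded support is subexponential if $\overline{G*G}(x)\sim2\overline G(x)$ as $x\to\infty$. The class $\mathcal S^*$ consists of the distributions $F$ on ${\bf R}^+$ with finite mean $m=\int_0^\infty\overline F(y)\,dy$ and $\overline F(x)>0$ for all $x$ such that $$\int_0^x\overline F(x-y)\overline F(y)\,dy\sim 2m\,\overline F(x)\quad\mbox{as }x\to\infty .$$ For $b>0$, $\mathcal H_b$ is the class of all non-zero non-negative measures $H$ on ${\bf R}^+$ (regarded as measures on ${\bf R}$ concentrated on ${\bf R}^+$) such that $\sup_{t\in{\bf R}}H((t,t+1])\le b$. *)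

(* Defs.v *)
From HB Require Import structures.
From mathcomp Require Import all_boot all_order all_algebra.
From mathcomp Require Import all_classical all_reals all_analysis.
From mathcomp Require Import measurable_realfun.

Set Implicit Arguments.
Unset Strict Implicit.
Unset Printing Implicit Defensive.

Import Order.TTheory GRing.Theory Num.Theory.
Import numFieldNormedType.Exports.

Local Open Scope classical_set_scope.
Local Open Scope ring_scope.

(* [fine] loses nothing here: [tail] is only applied to (convolutions of)
   probability measures. *)
Definition tail (R : realType) (mu : set R -> \bar R) (x : R) : R :=
  fine (mu `]x, +oo[%classic).

Definition on_nonneg (R : realType) (mu : set R -> \bar R) : Prop :=
  mu `]-oo, 0[%classic = 0%E.

Definition asymp_equiv (R : realType) (f g : R -> R) : Prop :=
  f x / g x @[x --> +oo] --> (1 : R).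

(* The law of the sum of two independent variables with laws G1 and G2. *)
Definition convolution (R : realType) (G1 G2 : probability R R) :
    set R -> \bar R :=
  pushforward (G1 \x G2)%E (fun p : R * R => p.1 + p.2).

Definition support_of (R : realType) (mu : set R -> \bar R) : set R :=
  [set x | forall e : R, 0 < e -> (0 < mu (ball x e))%E].

Definition subexponential (R : realType) (G : probability R R) : Prop :=
  [/\ on_nonneg G,
      ~ bounded_set (support_of G) &
      asymp_equiv (tail (convolution G G)) (fun x => 2 * tail G x)].

Definition mean (R : realType) (F : probability R R) : \bar R :=
  (\int[@lebesgue_measure R]_(y in `[0%R, +oo[) F `]y, +oo[%classic)%E.

Definition class_Sstar (R : realType) (F : probability R R) : Prop :=
  [/\ on_nonneg F,
      (mean F < +oo)%E,
      forall x : R, (0 < F `]x, +oo[%classic)%E &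
      asymp_equiv
        (fun x => \int[@lebesgue_measure R]_(y in `[0, x])
                    (tail F (x - y) * tail F y))
        (fun x => 2 * fine (mean F) * tail F x)].

Definition class_H (R : realType) (b : R) : set {measure set R -> \bar R} :=
  [set H | [/\ on_nonneg H, H setT != 0%E &
     (ereal_sup [set H `]t, (t + 1)%R]%classic | t in [set: R]] <= b%:E)%E]].

(* For x >= 0 the tail is the minimum of 1 and the H-mixture of shifted tails
   of F; no mass below 0, so such a G is determined (is_GH_unique). *)
Definition is_GH (R : realType) (F : probability R R)
    (H : {measure set R -> \bar R}) (G : probability R R) : Prop :=
  on_nonneg G /\
  forall x : R, 0 <= x ->
    G `]x, +oo[%classic = mine 1%:E (\int[H]_(t in `[0%R, +oo[) F `](x + t)%R, +oo[%classic)%E.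

(* [\d_0] is a junk value, never taken when F is in class_Sstar and H is in
   class_H b (GHP). *)
Definition GH (R : realType) (F : probability R R)
    (H : {measure set R -> \bar R}) : probability R R :=
  xget (\d_(0 : R) : probability R R) [set G | is_GH F H G].

Section GH_existence.
Context (R : realType) (F : probability R R) (b : R).
Context (H : {measure set R -> \bar R}).
Context (FS : class_Sstar F) (Hb : class_H b H).
Local Open Scope ereal_scope.

Let Fbar (t : R) : \bar R := F `]t, +oo[%classic.

Let Fbar_le (s t : R) : (s <= t)%R -> Fbar t <= Fbar s.
Proof.
move=> st; apply: le_measure; rewrite ?inE//.
by apply: subset_itvr; rewrite bnd_simp.
Qed.

Let diff (p : R * R) : R := (p.2 - p.1)%R.

Let measurable_diff : measurable_fun [set: R * R] diff.
Proof. by apply: measurable_realfun.measurable_funB; [exact: measurable_snd|exact: measurable_fst]. Qed.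

Let xsection_diff (x t : R) :
  xsection (diff @^-1` `]x, +oo[) t = `](x + t)%R, +oo[%classic.
Proof.
apply/seteqP; split => y; rewrite /xsection/diff/= inE/= !in_itv/= !andbT;
  by rewrite ltrBrDr.
Qed.

Let measurable_Fbar (x : R) :
  measurable_fun [set: R] (fun t : R => F `](x + t)%R, +oo[%classic : \bar R).
Proof.
rewrite (_ : (fun t => _) = F \o xsection (diff @^-1` `]x, +oo[)); last first.
  by apply/funext => t /=; rewrite xsection_diff.
apply: measurable_fun_xsection.
by rewrite -[X in measurable X]setTI; exact: measurable_diff.
Qed.

(* nu ]x, +oo[ is the H-mixture of the shifted tails of F at x. *)
Let nu : set R -> \bar R := pushforward (H \x F) diff.

Let nu0 : nu set0 = 0.
Proof. by rewrite /nu /pushforward preimage_set0 measure0. Qed.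

Let nu_ge0 A : 0 <= nu A.
Proof. exact: measure_ge0. Qed.

Let nu_sigma_additive : semi_sigma_additive nu.
Proof.
move=> A mA tA mUA; rewrite /nu /pushforward preimage_bigcup.
apply: measure_semi_sigma_additive.
- by move=> n; rewrite -[X in measurable X]setTI; exact: measurable_diff.
- apply/trivIsetP => i j _ _ ij; rewrite -preimage_setI.
  by move/trivIsetP : tA => ->//; rewrite preimage_set0.
- rewrite -preimage_bigcup -[X in measurable X]setTI; exact: measurable_diff.
Qed.

#[local] HB.instance Definition _ :=
  isMeasure.Build _ _ _ nu nu0 nu_ge0 nu_sigma_additive.

Let nuE (x : R) : nu `]x, +oo[%classic =
  \int[H]_(t in `[0%R, +oo[) F `](x + t)%R, +oo[%classic.
Proof.
rewrite /nu /pushforward /product_measure1.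
under eq_integral do rewrite /= xsection_diff.
have [H0 _ _] := Hb.
have mN : measurable (`]-oo, 0%R[%classic : set R) by [].
rewrite (@ge0_negligible_integral _ _ _ _ _ _ _ mN)//.
by congr integral; rewrite setTD setCitvl.
Qed.

Let Hle (t : R) : H `]t, (t + 1)%R]%classic <= b%:E.
Proof.
have [_ _] := Hb; apply: le_trans.
by apply: ereal_sup_ubound; exists t.
Qed.

Let Fseries : \sum_(0 <= n <oo) Fbar n.+1%:R < +oo.
Proof.
have [_ + _ _] := FS; apply: le_lt_trans.
rewrite /mean.
have mF : measurable_fun [set: R] Fbar.
  have := measurable_Fbar 0%R; rewrite (_ : (fun _ => _) = Fbar)//.
  by apply/funext => t; rewrite add0r.
have tr : trivIset [set: nat] (fun n : nat => `[n%:R, n.+1%:R[%classic : set R).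
  apply/trivIsetP => i j _ _ ij; apply/seteqP; split => // x /=.
  rewrite !in_itv/= => -[/andP[ix xi] /andP[jx xj]].
  have := le_lt_trans ix xj; have := le_lt_trans jx xi.
  rewrite !ltr_nat !ltnS => ji ij'.
  by move: ij; rewrite eqn_leq ji ij'.
apply: (@le_trans _ _ (\int[@lebesgue_measure R]_(y in \bigcup_n `[n%:R, n.+1%:R[%classic) Fbar y)).
  rewrite ge0_integral_bigcup//=; last exact: measurable_funS mF.
  apply: lee_nneseries => // n _.
  rewrite -[leLHS]mule1.
  have -> : 1 = @lebesgue_measure R `[n%:R, n.+1%:R[%classic.
    by rewrite lebesgue_measure_itv/= lte_fin ltr_nat ltnSn -EFinD -natrB// subSnn.
  rewrite -integral_cst//.
  apply: ge0_le_integral => //.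
    exact: measurable_funS mF.
  by move=> x /=; rewrite in_itv/= => /andP[_ /ltW]; exact: Fbar_le.
apply: ge0_subset_integral => //.
- exact: bigcup_measurable.
- exact: measurable_funS mF.
- by move=> x [n _]/=; rewrite !in_itv/= andbT => /andP[/(le_trans _)->].
Qed.

Let nu_fin : nu `]0%R, +oo[%classic < +oo.
Proof.
rewrite nuE.
have mF : measurable_fun [set: R] Fbar.
  have := measurable_Fbar 0%R; rewrite (_ : (fun _ => _) = Fbar)//.
  by apply/funext => t; rewrite add0r.
under eq_integral do rewrite add0r -/(Fbar _).
pose I (n : nat) : set R := `](n%:R - 1)%R, n%:R]%classic.
have tr : trivIset [set: nat] I.
  apply/trivIsetP => i j _ _ ij; apply/seteqP; split => // x /=.
  rewrite /I/= !in_itv/= => -[/andP[ix xi] /andP[jx xj]].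
  have := lt_le_trans ix xj; have := lt_le_trans jx xi.
  rewrite !ltrBlDr !natr1 !ltr_nat !ltnS => ji ij'.
  by move: ij; rewrite eqn_leq ji ij'.
have mI n : measurable (I n) by exact: measurable_itv.
have b0 : (0 <= b)%R by rewrite -lee_fin (le_trans _ (Hle 0)).
apply: (@le_lt_trans _ _ (\int[H]_(y in \bigcup_n I n) Fbar y)).
  apply: ge0_subset_integral => //.
  - exact: bigcup_measurable.
  - exact: measurable_funS mF.
  - move=> x/=; rewrite in_itv/= andbT => x0.
    exists `|Num.ceil x|%N => //.
    have cx : (0 <= Num.ceil x)%R by rewrite ceil_ge0 (lt_le_trans _ x0)// ltrN10.
    rewrite /I/= in_itv/= natr_absz ger0_norm//.
    by have := ceil_itv x; rewrite intrB.
rewrite ge0_integral_bigcup//=; last exact: measurable_funS mF.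
apply: (@le_lt_trans _ _ (\sum_(0 <= n <oo) b%:E * Fbar (n%:R - 1)%R)).
  apply: lee_nneseries => [n _ _|n _]; first exact: integral_ge0.
  apply: (@le_trans _ _ (\int[H]_(x in I n) cst (Fbar (n%:R - 1)%R) x)).
    apply: ge0_le_integral => //.
      exact: measurable_funS mF.
    by move=> x /=; rewrite /I/= in_itv/= => /andP[/ltW + _]; exact: Fbar_le.
  rewrite integral_cst// muleC lee_wpmul2r//.
  by have := Hle (n%:R - 1)%R; rewrite subrK.
rewrite nneseriesZl// lte_mul_pinfty//.
rewrite (nneseries_split 0 2)//= add0n -nneseries_addn//.
under eq_eseriesr do rewrite addn2 -natr1 addrK.
rewrite lte_add_pinfty// !big_nat_recr//= big_nil add0r lte_add_pinfty//;
  exact: le_lt_trans (probability_le1 _ _) (ltry _).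
Qed.

Let nu_gt (x : R) : (0 <= x)%R -> nu `]x, +oo[%classic < +oo.
Proof.
move=> x0; apply: le_lt_trans nu_fin; apply: le_measure; rewrite ?inE//.
by apply: subset_itvr; rewrite bnd_simp.
Qed.

Let nu_le (s t : R) : (s <= t)%R ->
  nu `]t, +oo[%classic <= nu `]s, +oo[%classic.
Proof.
move=> st; apply: le_measure; rewrite ?inE//.
by apply: subset_itvr; rewrite bnd_simp.
Qed.

Let E : set R := [set x | (0 <= x)%R /\ nu `]x, +oo[%classic <= 1].

Let E_neq0 : E !=set0.
Proof.
have : nu `]n%:R, +oo[%classic @[n --> \oo] --> nu (\bigcap_n `]n%:R, +oo[%classic).
  apply: (@nonincreasing_cvg_mu _ _ _ nu (fun n => `]n%:R, +oo[%classic : set R)) => //.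
  - exact: bigcap_measurable.
  - move=> m n mn; apply/subsetPset; apply: subset_itvr.
    by rewrite bnd_simp ler_nat.
rewrite (_ : \bigcap_n _ = set0); last first.
  apply/seteqP; split => // x /(_ (Num.truncn x).+1 I)/=.
  rewrite in_itv/= andbT => /ltW; rewrite leNgt => /negP; apply.
  exact: truncnS_gt.
rewrite nu0 => h; apply/set0P/eqP => E0.
have : 1 <= limn (fun n => nu `]n%:R, +oo[%classic).
  apply: lime_ge; first by apply/cvg_ex; eexists; exact: h.
  apply: nearW => n; rewrite leNgt; apply/negP => /ltW n1.
  by have : E n%:R by []; rewrite E0.
by rewrite (cvg_lim _ h)// leNgt lte01.
Qed.

Let x0 : R := inf E.

Let E_lb : has_lbound E. Proof. by exists 0%R => x []. Qed.

Let x0_ge0 : (0 <= x0)%R.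
Proof. by apply: lb_le_inf => // x []. Qed.

Let nu_x0 : nu `]x0, +oo[%classic <= 1.
Proof.
have : nu `[(x0 + n.+1%:R^-1)%R, +oo[%classic @[n --> \oo] -->
    nu (\bigcup_n `[(x0 + n.+1%:R^-1)%R, +oo[%classic).
  apply: (@nondecreasing_cvg_mu _ _ _ nu (fun n => `[(x0 + n.+1%:R^-1)%R, +oo[%classic : set R)) => //.
  - exact: bigcup_measurable.
  - move=> m n mn; apply/subsetPset; apply: subset_itvr.
    by rewrite bnd_simp lerD2l lef_pV2 ?posrE// ler_nat.
rewrite -itvoyEbigcup => h; rewrite -(cvg_lim _ h)//.
apply: lime_le; first by apply/cvg_ex; eexists; exact: h.
near=> n.
have [e [e0 e1] ee] : exists2 e, E e & (e < x0 + n.+1%:R^-1)%R.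
  by apply: inf_lt => //; rewrite ltrDl.
apply: le_trans e1; apply: le_measure; rewrite ?inE//.
by apply: subset_itvr; rewrite bnd_simp.
Unshelve. all: by end_near. Qed.

Let nu_lt_x0 (x : R) : (0 <= x)%R -> (x < x0)%R -> 1 <= nu `]x, +oo[%classic.
Proof.
move=> x_ge0 xx0; rewrite leNgt; apply/negP => /ltW nu1.
by move: xx0; rewrite ltNge => /negP; apply; apply: ge_inf.
Qed.

Let mass_ge0 : (0 <= 1 - fine (nu `]x0, +oo[%classic))%R.
Proof.
rewrite subr_ge0 -lee_fin fineK// ge0_fin_numE//.
exact: nu_gt.
Qed.

Let mx0 : measurable (`]x0, +oo[%classic : set R). Proof. by []. Qed.

Lemma is_GH_exists : exists G, is_GH F H G.
Proof.
pose mu : {measure set R -> \bar R} :=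
  measure_add (mrestr nu mx0) (mscale (NngNum mass_ge0) (\d_x0)).
have muE A : mu A = nu (A `&` `]x0, +oo[%classic) +
    (1 - fine (nu `]x0, +oo[%classic))%:E * \d_x0 A by exact: measure_addE.
have massE : nu `]x0, +oo[%classic + (1 - fine (nu `]x0, +oo[%classic))%:E = 1.
  have nu_num : nu `]x0, +oo[%classic \is a fin_num.
    by rewrite ge0_fin_numE//; exact: nu_gt.
  by rewrite EFinB fineK// [LHS]addeC subeK.
have muT : mu setT = 1.
  by rewrite muE setTI diracT mule1.
exists (mnormalize mu (\d_x0)).
have GE A : mnormalize mu \d_x0 A = mu A.
  by rewrite /mnormalize muT onee_eq0/= invr1 mule1.
split.
  rewrite /on_nonneg/= GE muE (_ : _ `&` _ = set0); last first.
    apply/seteqP; split => // x /=; rewrite !in_itv/= andbT => -[xlt0].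
    by move=> /(lt_trans)/(_ xlt0); rewrite ltNge x0_ge0.
  by rewrite measure0 add0e diracE memNset ?mule0//= in_itv/= ltNge x0_ge0.
move=> x x_ge0; rewrite /= GE muE -nuE.
have [xx0|x0x] := ltP x x0.
  rewrite (_ : _ `&` _ = `]x0, +oo[%classic); last first.
    by apply: setIidr; apply: subset_itvr; rewrite bnd_simp ltW.
  rewrite diracE mem_set/= ?mule1 ?massE ?in_itv/= ?xx0//.
  by rewrite min_l// nu_lt_x0.
rewrite (_ : _ `&` _ = `]x, +oo[%classic); last first.
  by apply: setIidl; apply: subset_itvr; rewrite bnd_simp.
rewrite diracE memNset ?mule0 ?adde0/= ?in_itv/= ?andbT; last first.
  by apply/negP; rewrite -leNgt.
by rewrite min_r// (le_trans _ nu_x0)// nu_le.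
Qed.
End GH_existence.

Lemma GHP (R : realType) (F : probability R R) (b : R)
    (H : {measure set R -> \bar R}) :
  class_Sstar F -> class_H b H -> is_GH F H (GH F H).
Proof. by move=> FS Hb; apply: xgetPex; exact: is_GH_exists FS Hb. Qed.

Lemma is_GH_unique (R : realType) (F : probability R R)
    (H : {measure set R -> \bar R}) (G G' : probability R R) :
  is_GH F H G -> is_GH F H G' -> forall A, measurable A -> G A = G' A.
Proof.
move=> [G0 GE] [G'0 G'E].
have ray (P : probability R R) (x : R) : P `]-oo, 0[%classic = 0%E -> x < 0 ->
    P `]x, +oo[%classic = 1%E.
  move=> P0 x0; rewrite -[X in P X]setCitvl probability_setC// (_ : P _ = 0%E) ?sube0//.
  apply/eqP; rewrite eq_le measure_ge0 andbT -P0; apply: le_measure; rewrite ?inE//.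
  by apply: subset_itvl; rewrite bnd_simp.
have GG' (x : R) : G `]x, +oo[%classic = G' `]x, +oo[%classic.
  by have [x0|x0] := ltP x 0; [rewrite !ray|rewrite GE// G'E].
have oc (x y : R) : x <= y -> G `]x, y]%classic = G' `]x, y]%classic.
  move=> xy.
  have D (P : probability R R) :
      P `]x, y]%classic = (P `]x, +oo[%classic - P `]y, +oo[%classic)%E.
    rewrite (_ : `]x, y]%classic = `]x, +oo[%classic `\` `]y, +oo[%classic); last first.
      by rewrite setDE setCitvr -set_itvI/= /Order.meet/= /Order.meet/= /Order.join/= ?(andbF, orbF)/= ?(meetEtotal, joinEtotal).
    rewrite measureD//; last by rewrite ltey_eq fin_num_measure.
    by rewrite setIidr//; apply: subset_itvr; rewrite bnd_simp.
  by rewrite !D !GG'.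
move=> A mA; apply: (@measure_unique _ R R (@ocitv R) (fun n => `](- n%:R)%R, n%:R]%classic)) => //.
- exact: ocitvI.
- by move=> n; exists (- n%:R, n%:R).
- exact: bigcup_itvT.
- move=> _ [[x y] _ <-] /=; have [xy|yx] := leP x y; first exact: oc.
  by rewrite set_itv_ge ?measure0// bnd_simp -leNgt ltW.
- by move=> n; rewrite (le_lt_trans (probability_le1 _ _)) ?ltry.
Qed.

(* Main.v *)
From HB Require Import structures.
Require Import Defs.
From mathcomp Require Import all_boot all_order all_algebra.
From mathcomp Require Import all_classical all_reals all_analysis.
From mathcomp Require Import measurable_realfun lra.
Import Order.TTheory GRing.Theory Num.Theory.
Import numFieldNormedType.Exports.
Local Open Scope classical_set_scope.
Local Open Scope ring_scope.

Set Implicit Arguments.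
Unset Strict Implicit.
Unset Printing Implicit Defensive.

(** Write [f] for the tail of [F], [m] for its mean, [g] for the mixture
[x |-> \int f (x + t) H(dt)] and [T] for the tail of [G = GH F H]; [T] agrees
with [g] as soon as [g <= 1].

The condition defining the class of [F] has two consequences
for [f] alone, both read off from the symmetry [y <-> x - y] of the integrand
[f (x - y) * f y], which splits the integral over [0, x] into twice the one over
[0, d[ plus the one over [d, x - d] ([tail_conv_split]). On [0, d[ the factor
[f (x - y)] is at least [f x], so the two end pieces already contribute
almost [2 * m * f x]. Since the whole integral is at most about [2 * m * f x],
- the middle piece is at most [e * f x] once [d] is large ([tail_conv_middle]);
- [f] is long-tailed, that is, [f (x - a) <= (1 + e) * f x] for large [x]
  ([tail_shift]): otherwise the points of [a, d[ would make the end pieces too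
  large.

The measure [H] enters only through the bound [b] on its mass on
unit intervals, which is what makes everything uniform in [H]. It gives
- [g x <= b * \sum_k f (x - 1 + k)], which tends to [0] uniformly
  ([mix_tail_small]), so that [T] and [g] agree beyond a point independent of [H];
- [G ]n, n + 1] <= 2 * b * f (n - 1)] ([mix_tail_increment]), because the
  increments of [f] over windows of length [2] overlap at most twice and
  telescope.
Inequalities that are linear in shifts of [f] pass to [g] by integration
against [H].

For two independent variables [X], [Y] of law [G], the event [X + Y > x] contains
[max X Y > x], whence [2 * T x - T x ^+ 2] as a lower bound. Conversely, apart
from [X <= A], [Y <= A] and one term [T N * T A], it is covered by the events
[n < X <= n + 1, Y > x - n - 1] with [A <= n < N], where [N] is
about [x - A] ([tail_convolution_le]). By the increment
bound their total probability is at most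
[2 * b * \sum_n f (n - 1) * g (x - n - 1)], which is the [H]-mixture over [t] of the
sums [\sum_n f (n - 1) * f (x + t - n - 1)]; these are discrete versions of the middle
piece, hence at most [e * f (x + t)] ([sum_tail_middle]), and the mixture is at most
[e * g x]. Altogether the tail of the convolution is at most [(2 + e') * T x], with
[e'] independent of [H]. *)

(** * Tails of a distribution *)

Section Tail.
Context (R : realType) (F : probability R R).

Lemma tailE (x : R) : F `]x, +oo[%classic = (tail F x)%:E.
Proof. by rewrite /tail fineK// fin_num_measure. Qed.

Lemma tail_ge0 (x : R) : 0 <= tail F x.
Proof. by rewrite fine_ge0. Qed.

Lemma tail_le1 (x : R) : tail F x <= 1.
Proof. by rewrite -lee_fin -tailE probability_le1. Qed.

Lemma le_tail (x y : R) : x <= y -> tail F y <= tail F x.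
Proof.
move=> xy; rewrite -lee_fin -!tailE; apply: le_measure; rewrite ?inE//.
by apply: subset_itvr; rewrite bnd_simp.
Qed.

Lemma measurable_tail (D : set R) : measurable D -> measurable_fun D (tail F).
Proof.
by move=> mD; apply: nonincreasing_measurable => // x y xy; exact: le_tail.
Qed.

Lemma tail_itvoc (x y : R) : x <= y ->
  F `]x, y]%classic = (tail F x - tail F y)%:E.
Proof.
move=> xy; rewrite EFinB -!tailE.
have xyE : `]x, +oo[%classic = `]x, y]%classic `|` `]y, +oo[%classic :> set R.
  rewrite -itv_bndbnd_setU// ?bnd_simp//.
rewrite xyE measureU//; last first.
  by apply/seteqP; split => z //= []; rewrite !in_itv/= andbT => /andP[_ /le_lt_trans h /h]; rewrite ltxx.
by rewrite addeK// fin_num_measure.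
Qed.

End Tail.

(** * Self-convolution integrals of a tail *)

Section SelfConv.
Context (R : realType) (F : probability R R).
Notation leb := (@lebesgue_measure R).
Notation f := (tail F).

Definition tail_mass (D : set R) : \bar R := (\int[leb]_(y in D) (f y)%:E)%E.

(** For [D = `[0, x]] this is the integral whose asymptotics defines the class of
[F]; arbitrary [D] lets that integral be cut into pieces. *)
Definition tail_conv (x : R) (D : set R) : \bar R :=
  (\int[leb]_(y in D) (f (x - y) * f y)%:E)%E.

Lemma measurable_tail_conv x (D : set R) : measurable D ->
  measurable_fun D (fun y => (f (x - y) * f y)%:E).
Proof.
move=> mD; apply/measurable_EFinP/measurable_funM; last exact: measurable_tail.
apply: (@measurableT_comp _ _ _ _ _ _ f); first exact: measurable_tail.
exact: measurable_funB.
Qed.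

Lemma measurable_EFin_tail (D : set R) : measurable D ->
  measurable_fun D (fun y => (f y)%:E).
Proof. by move=> mD; apply/measurable_EFinP; exact: measurable_tail. Qed.

Lemma tail_conv_ge0 x D : (0 <= tail_conv x D)%E.
Proof. by apply: integral_ge0 => y _; rewrite lee_fin mulr_ge0// tail_ge0. Qed.

Lemma tail_mass_ge0 D : (0 <= tail_mass D)%E.
Proof. by apply: integral_ge0 => y _; rewrite lee_fin tail_ge0. Qed.

Lemma tail_conv_setU x A B : measurable A -> measurable B ->
  [disjoint A & B] -> tail_conv x (A `|` B) = (tail_conv x A + tail_conv x B)%E.
Proof.
move=> mA mB AB; rewrite /tail_conv ge0_integral_setU//.
  by apply: measurable_tail_conv; exact: measurableU.
by move=> y _; rewrite lee_fin mulr_ge0// tail_ge0.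
Qed.

Lemma tail_mass_setU A B : measurable A -> measurable B ->
  [disjoint A & B] -> tail_mass (A `|` B) = (tail_mass A + tail_mass B)%E.
Proof.
move=> mA mB AB; rewrite /tail_mass ge0_integral_setU//.
  by apply: measurable_EFin_tail; exact: measurableU.
by move=> y _; rewrite lee_fin tail_ge0.
Qed.

(** Monotonicity bounds the shifted factor [f (x - y)] below by the constant [f c]. *)
Lemma tail_conv_lower x c (D : set R) : measurable D ->
  (forall y, D y -> x - c <= y) -> ((f c)%:E * tail_mass D <= tail_conv x D)%E.
Proof.
move=> mD Dc; rewrite /tail_mass -ge0_integralZl_EFin ?tail_ge0//.
- apply: ge0_le_integral => //.
  + by move=> y _; rewrite mule_ge0// lee_fin tail_ge0.
  + by apply: measurable_funeM; exact: measurable_EFin_tail.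
  + exact: measurable_tail_conv.
  + move=> y Dy; rewrite -EFinM lee_fin ler_wpM2r ?tail_ge0//.
    apply: le_tail. have := Dc _ Dy. lra.
- by move=> y _; rewrite lee_fin tail_ge0.
- exact: measurable_EFin_tail.
Qed.

Lemma lebesgue_measure_reflect (x : R) (A : set R) : measurable A ->
  pushforward leb (fun y => x - y) A = leb A.
Proof.
move=> mA.
have mh : measurable_fun [set: measurableTypeR R] (fun y : measurableTypeR R => x - y : measurableTypeR R).
  exact: measurable_funB.
pose h : {mfun measurableTypeR R >-> measurableTypeR R} :=
  HB.pack (fun y => x - y) (isMeasurableFun.Build _ _ _ _ _ mh).
apply/esym; rewrite -[RHS]/(pushforward leb h A).
apply: lebesgue_measure_unique => //= _ [[a b]] _ <-.
rewrite /pushforward/=.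
rewrite (_ : _ @^-1` _ = `[x - b, x - a[%classic); last first.
  by apply/seteqP; split => z /=; rewrite !in_itv/= => /andP[? ?]; apply/andP; split; lra.
rewrite !lebesgue_measure_itv/= !lte_fin ltrD2l ltrN2.
by case: ifP => // _; congr (_%:E); lra.
Qed.

Lemma tail_conv_reflect x D : measurable D ->
  tail_conv x ((fun y => x - y) @^-1` D) = tail_conv x D.
Proof.
move=> mD.
have mh : measurable_fun [set: measurableTypeR R] (fun y : measurableTypeR R => x - y : measurableTypeR R).
  exact: measurable_funB.
pose refl (y : measurableTypeR R) : measurableTypeR R := (x - y)%R.
transitivity (\int[pushforward leb refl]_(y in D) (f (x - y) * f y)%:E)%E.
  rewrite ge0_integral_pushforward//; last 2 first.
  - exact: measurable_tail_conv.
  - by move=> y _; rewrite lee_fin mulr_ge0// tail_ge0.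
  apply: eq_integral => y _ /=; congr (_%:E).
  by rewrite mulrC /refl subKr.
by apply: eq_measure_integral => A mA _; exact: lebesgue_measure_reflect.
Qed.

(** The reflection [y |-> x - y] exchanges [0, d[ and ]x - d, x] and leaves the
integrand unchanged, so that both ends contribute equally. *)
Lemma tail_conv_split (x d : R) : 0 <= d -> d <= x - d ->
  tail_conv x `[0%R, x] = (tail_conv x `[0%R, d[ + tail_conv x `[0%R, d[
    + tail_conv x `[d, (x - d)%R])%E.
Proof.
move=> d0 dx.
rewrite -[X in (_ + X + _)%E]tail_conv_reflect//.
rewrite (_ : _ @^-1` _ = `]x - d, x]%classic); last first.
  by apply/seteqP; split => z /=; rewrite !in_itv/= => /andP[? ?]; apply/andP; split; lra.
rewrite -addeA [X in (_ + X)%E]addeC.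
rewrite -tail_conv_setU//; last first.
  by apply/disj_setPS => y [] /=; rewrite !in_itv/= => /andP[? ?] /andP[? ?]; exfalso; lra.
rewrite -itv_bndbnd_setU ?bnd_simp//; last by lra.
rewrite -tail_conv_setU//; last first.
  by apply/disj_setPS => y [] /=; rewrite !in_itv/= => /andP[? ?] /andP[? ?]; exfalso; lra.
by rewrite -itv_bndbnd_setU ?bnd_simp//; lra.
Qed.

End SelfConv.

(** * Long tails and negligible middle parts *)

Section Sstar.
Context (R : realType) (F : probability R R).
Hypothesis FS : class_Sstar F.
Notation f := (tail F).
Notation m := (fine (mean F)).

Lemma tail_gt0 (x : R) : 0 < f x.
Proof. by have [_ _ h _] := FS; have := h x; rewrite tailE lte_fin. Qed.

Lemma meanE : mean F = tail_mass F `[0%R, +oo[.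
Proof. by apply: eq_integral => y _; rewrite tailE. Qed.

Lemma mean_fineK : (m%:E = mean F)%E.
Proof.
have [_ h _ _] := FS; rewrite fineK// ge0_fin_numE// meanE.
exact: tail_mass_ge0.
Qed.

Lemma tail_mass_itv_le (a d : R) : a <= d ->
  (((d - a) * f d)%:E <= tail_mass F `[a, d[)%E.
Proof.
move=> ad; rewrite /tail_mass.
have <- : (\int[@lebesgue_measure R]_(y in `[a, d[) (f d)%:E = ((d - a) * f d)%:E)%E.
  rewrite integral_cst//= lebesgue_measure_itv/= lte_fin mulrC.
  case: ltP => [//|da]; have -> : d = a by lra.
  by rewrite mule0 subrr mulr0.
apply: ge0_le_integral => //.
- by move=> y _; rewrite lee_fin tail_ge0.
- exact: measurable_EFin_tail.
- by move=> y /=; rewrite in_itv/= lee_fin => /andP[_ /ltW]; exact: le_tail.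
Qed.

Lemma tail_mass_le_mean (d : R) : (tail_mass F `[0%R, d[ <= m%:E)%E.
Proof.
rewrite mean_fineK meanE; apply: ge0_subset_integral => //.
- exact: measurable_EFin_tail.
- by move=> y _; rewrite lee_fin tail_ge0.
- by move=> y /=; rewrite !in_itv/= andbT => /andP[].
Qed.

Lemma mean_gt0 : 0 < m.
Proof.
rewrite -lte_fin; apply: lt_le_trans (tail_mass_le_mean 1).
apply: lt_le_trans (tail_mass_itv_le ler01).
by rewrite lte_fin subr0 mul1r tail_gt0.
Qed.

Lemma tail_mass_cvg (e : R) : 0 < e ->
  exists N : nat, forall d : R, N%:R <= d -> ((m - e)%:E <= tail_mass F `[0%R, d[)%E.
Proof.
move=> e0.
pose I (i : nat) : set R := `[0, i%:R[%classic.
have sI i j : (i <= j)%N -> I i `<=` I j.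
  move=> ij y; rewrite /I/= !in_itv/= => /andP[-> /lt_le_trans->//].
  by rewrite ler_nat.
have : tail_mass F (I i) @[i --> \oo] --> tail_mass F (\bigcup_i I i).
  apply: ge0_nondecreasing_set_cvg_integral.
  - by move=> i j ij; apply/subsetPset/sI.
  - by move=> i; exact: measurable_itv.
  - by move=> i; apply: measurable_EFin_tail; exact: measurable_itv.
  - by move=> i y _; rewrite lee_fin tail_ge0.
have -> : \bigcup_i I i = `[0, +oo[%classic.
  apply/seteqP; split => y /=; first by move=> [i _]; rewrite /I/= !in_itv/= andbT => /andP[].
  rewrite in_itv/= andbT => y0; exists (Num.truncn y).+1 => //.
  by rewrite /I/= in_itv/= y0 truncnS_gt.
rewrite -meanE -mean_fineK => /fine_cvgP[_ /cvgrPdist_lt/(_ _ e0)[N _ hN]].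
exists N => d Nd; have /= := hN N (leqnn N).
have fin : tail_mass F (I N) \is a fin_num.
  rewrite ge0_fin_numE ?tail_mass_ge0//.
  exact: le_lt_trans (tail_mass_le_mean _) (ltry _).
move=> /ltr_distlBl h.
apply: (@le_trans _ _ (tail_mass F (I N))).
  by rewrite -[leRHS]fineK// lee_fin ltW.
apply: ge0_subset_integral => //.
- exact: measurable_itv.
- exact: measurable_EFin_tail.
- by move=> y _; rewrite lee_fin tail_ge0.
- by move=> y; rewrite /I/= !in_itv/= => /andP[-> /lt_le_trans->].
Qed.

Lemma tail_conv_fin (x : R) : tail_conv F x `[0%R, x] \is a fin_num.
Proof.
rewrite ge0_fin_numE ?tail_conv_ge0//.
apply: (@le_lt_trans _ _ (\int[@lebesgue_measure R]_(y in `[0%R, x]) 1)%E).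
  apply: ge0_le_integral => //.
  - by move=> y _; rewrite lee_fin mulr_ge0// tail_ge0.
  - exact: measurable_tail_conv.
  - by move=> y _; rewrite lee_fin mulr_ile1// ?tail_ge0// tail_le1.
rewrite integral_cst//= mul1e lebesgue_measure_itv/=; case: ifP => _; rewrite ?ltry//.
Qed.

(** The relative error [e / (2 * m)] in the asymptotic equivalence, multiplied out:
[mean_gt0] makes this a legitimate choice. *)
Lemma Sstar_upper (e : R) : 0 < e ->
  exists x0 : R, forall x, x0 <= x ->
    (tail_conv F x `[0%R, x] <= ((2 * m + e) * f x)%:E)%E.
Proof.
move=> e0; have [_ _ _ +] := FS; rewrite /asymp_equiv.
have m0 := mean_gt0.
have d0 : 0 < e / (2 * m) by rewrite divr_gt0// mulr_gt0.
move=> /cvgrPdist_lt/(_ _ d0)[M [_ hM]].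
exists (M + 1) => x Mx.
have /hM/= : M < x by lra.
rewrite -[leLHS]fineK ?tail_conv_fin// lee_fin -/(fine _).
rewrite /Rintegral -/(tail_conv F x `[0, x]).
set I := fine (tail_conv _ _ _) => /ltr_distlCDr.
have fx := tail_gt0 x.
have mf : 0 < 2 * m * f x by rewrite !mulr_gt0.
rewrite ltr_pdivrMr// => /ltW/le_trans; apply.
by rewrite mulrA mulrDl mul1r divfK// gt_eqF// mulr_gt0.
Qed.

(** Fix [d] with the mass of [0, d[ within [th] of the mean. The two end pieces
of the self-convolution integral are each at least
[f x * mass [0, a[ + f (x - a) * mass [a, d[], and together at most
[(2 * m + th) * f x]; comparing leaves
[f (x - a) * mass [a, d[ <= (mass [a, d[ + 2 * th) * f x]. *)
Lemma tail_shift (a e : R) : 0 <= a -> 0 < e ->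
  exists x0 : R, forall x, x0 <= x -> f (x - a) <= (1 + e) * f x.
Proof.
move=> a0 e0; have fa := tail_gt0 (a + 1).
(* [f (a + 1)] bounds the mass of [a, d[ below uniformly in [d], so an error
   proportional to it can be absorbed. *)
pose th := e * f (a + 1) / 2.
have th0 : 0 < th by rewrite /th divr_gt0// mulr_gt0.
have [N hN] := tail_mass_cvg th0.
have [x0 hx0] := Sstar_upper th0.
pose d := N%:R + a + 1 : R.
have d_ge : 0 <= d by rewrite !addr_ge0.
have ad : a + 1 <= d by rewrite /d -addrA lerDr.
exists (Num.max x0 (d + d)) => x; rewrite ge_max => /andP[xx0 xd].
have := hx0 _ xx0.
rewrite (@tail_conv_split _ F x d)//; last by lra.
move=> H1.
have : (tail_conv F x `[0%R, d[ + tail_conv F x `[0%R, d[ <= ((2 * m + th) * f x)%:E)%E.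
  by apply: le_trans H1; rewrite leeDl// tail_conv_ge0.
have dsplit : `[0, d[%classic = `[0, a[%classic `|` `[a, d[%classic :> set R.
  by rewrite -itv_bndbnd_setU ?bnd_simp//; lra.
have disj : [disjoint (`[0, a[%classic : set R) & `[a, d[%classic].
  by apply/disj_setPS => y [] /=; rewrite !in_itv/= => /andP[? ?] /andP[? ?]; exfalso; lra.
have L1 : ((f x)%:E * tail_mass F `[0%R, a[ <= tail_conv F x `[0%R, a[)%E.
  by apply: tail_conv_lower => // y /=; rewrite in_itv/= subrr => /andP[].
have L2 : ((f (x - a))%:E * tail_mass F `[a, d[ <= tail_conv F x `[a, d[)%E.
  by apply: tail_conv_lower => // y /=; rewrite in_itv/= => /andP[? ?]; lra.
have := hN d; rewrite dsplit tail_mass_setU// tail_conv_setU//.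
have : N%:R <= d by rewrite /d -addrA lerDl addr_ge0.
move=> Nd /(_ Nd).
have P := tail_mass_le_mean d; rewrite dsplit tail_mass_setU// in P.
have Q : ((f (a + 1))%:E <= tail_mass F `[a, d[)%E.
  apply: (@le_trans _ _ (tail_mass F `[a, (a + 1)%R[)).
    have := @tail_mass_itv_le a (a + 1); rewrite (addrC a) addrK mul1r; apply; lra.
  apply: ge0_subset_integral => //.
  - exact: measurable_EFin_tail.
  - by move=> y _; rewrite lee_fin tail_ge0.
  - by move=> y /=; rewrite !in_itv/= => /andP[-> /lt_le_trans->].
have c1 := tail_conv_ge0 F x `[0%R, a[.
have c2 := tail_conv_ge0 F x `[a, d[.
have m1 := tail_mass_ge0 F `[0%R, a[.
have m2 := tail_mass_ge0 F `[a, d[.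
(* All these quantities are finite; the rest is real arithmetic. *)
move: L1 L2 P Q c1 c2 m1 m2.
move: (tail_mass F `[0%R, a[%classic) (tail_mass F `[a, d[%classic).
move: (tail_conv F x `[0%R, a[%classic) (tail_conv F x `[a, d[%classic).
move=> [C1||] [C2||] [M1||] [M2||] //.
rewrite -!EFinM -!EFinD !lee_fin => L1 L2 P Q c1 c2 m1 m2 U V.
have fx := tail_gt0 x.
have fxa : f x <= f (x - a) by apply: le_tail; lra.
have key : f (x - a) * M2 <= (M2 + 2 * th) * f x.
  have := ler_wpM2r (ltW fx) U; nra.
have M2th : M2 + 2 * th <= (1 + e) * M2.
  have := ler_wpM2l (ltW e0) Q; rewrite /th; lra.
have M20 : 0 < M2 by lra.
rewrite -(ler_pM2r M20); apply: (le_trans key).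
by rewrite mulrAC ler_pM2r.
Qed.

(** The end pieces use up [2 * f x * mass [0, B[], that is, nearly all of
the available [2 * m * f x]. *)
Lemma tail_conv_middle (e B0 : R) : 0 < e ->
  exists2 B : nat, B0 <= B%:R & exists w0 : R, forall w, w0 <= w ->
    (tail_conv F w `[B%:R, (w - B%:R)%R] <= (e * f w)%:E)%E.
Proof.
move=> e0; have e3 : 0 < e / 3 by rewrite divr_gt0.
have [N hN] := tail_mass_cvg e3.
have [x0 hx0] := Sstar_upper e3.
pose B := (N + (Num.truncn B0).+1)%N.
exists B.
  by rewrite /B natrD; apply: (le_trans (ltW (truncnS_gt B0))); rewrite lerDr.
exists (Num.max x0 (B%:R + B%:R)) => w; rewrite ge_max => /andP[xx0 xd].
have := hx0 _ xx0.
rewrite (@tail_conv_split _ F w B%:R)//; last by lra.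
have L : ((f w)%:E * tail_mass F `[0%R, B%:R[ <= tail_conv F w `[0%R, B%:R[)%E.
  by apply: tail_conv_lower => // y /=; rewrite in_itv/= subrr => /andP[].
have : N%:R <= B%:R :> R by rewrite ler_nat leq_addr.
move=> /hN.
have c1 := tail_conv_ge0 F w `[0%R, B%:R[.
have c2 := tail_conv_ge0 F w `[B%:R, (w - B%:R)%R].
have m1 := tail_mass_ge0 F `[0%R, B%:R[.
have P := tail_mass_le_mean B%:R.
move: L P c1 c2 m1.
move: (tail_conv F w `[0%R, B%:R[%classic) (tail_conv F w `[B%:R, (w - B%:R)%R]%classic).
move: (tail_mass F `[0%R, B%:R[%classic).
move=> [M1||] [C1||] [C2||] //.
rewrite -!EFinM -!EFinD !lee_fin => L P c1 c2 m1 U V.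
have fx := tail_gt0 w; nra.
Qed.

End Sstar.

Section SstarSum.
Context (R : realType) (F : probability R R).
Hypothesis FS : class_Sstar F.
Notation f := (tail F).

Lemma tail_conv_itv_ge (x y : R) :
  ((f (x - y) * f (y + 1))%:E <= tail_conv F x `[y, (y + 1)%R[)%E.
Proof.
have := @tail_conv_lower _ F x (x - y) `[y, (y + 1)%R[.
have h := @tail_mass_itv_le _ F y (y + 1).
move=> H; apply: le_trans (H _ _) => //.
- rewrite EFinM lee_wpmul2l ?lee_fin ?tail_ge0//.
  by move: h; rewrite (addrC y) addrK mul1r; apply; lra.
- by move=> z /=; rewrite in_itv/= => /andP[? _]; lra.
Qed.

Lemma sum_tail_le_tail_conv (x : R) (A N : nat) : (A <= N)%N ->
  ((\sum_(A <= n < N) f (x - n%:R) * f (n%:R + 1))%R%:E <=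
    tail_conv F x `[A%:R, N%:R[)%E.
Proof.
move=> AN; rewrite -(subnKC AN); elim: (N - A)%N => [|k IH].
  by rewrite addn0 big_geq// tail_conv_ge0.
rewrite addnS big_nat_recr ?leq_addr//= EFinD.
set n := (A + k)%N in IH *.
have An : A%:R <= n%:R :> R by rewrite ler_nat leq_addr.
rewrite (_ : `[A%:R, n.+1%:R[%classic = `[A%:R, n%:R[%classic `|` `[n%:R, (n%:R + 1)[%classic); last first.
  by rewrite -natr1 -itv_bndbnd_setU// bnd_simp; lra.
rewrite tail_conv_setU//; last first.
  by apply/disj_setPS => y [] /=; rewrite !in_itv/= => /andP[_ /lt_le_trans h] /andP[/h]; rewrite ltxx.
by rewrite leeD// tail_conv_itv_ge.
Qed.

(** The form in which the negligible middle is used: the unit cell [n - 2, n - 1[ of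
the integral at [x - 3] dominates the [n]-th term of the sum. *)
Lemma sum_tail_middle (e : R) (B0 : nat) : 0 < e ->
  exists2 A : nat, (B0 <= A)%N & exists x0 : R, forall (x : R) (N : nat), x0 <= x -> N%:R <= x - A%:R ->
    \sum_(A <= n < N) f (x - n.+1%:R) * f (n%:R - 1) <= e * f x.
Proof.
move=> e0; have e2 : 0 < e / 2 by rewrite divr_gt0.
have [B B0B [w0 hw]] := @tail_conv_middle _ F FS (e / 2) B0%:R e2.
have [x1 hx1] := @tail_shift _ F FS 3 1 (ler0n _ 3) ltr01.
(* Aligning [f (n - 1)] with the right end of a cell [y, y + 1[, so [y = n - 2], forces
   the other factor [f (x - n - 1)] to be [f (x - 3 - y)]: this shifts the lower
   index by [2] and the argument by [3]. *)
exists B.+2; first by rewrite -(ler_nat R) (le_trans B0B)// ler_nat leqW.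
exists (Num.max x1 (w0 + 3)) => x N; rewrite ge_max => /andP[xx1 xw0] NA.
have [NB|BN] := leqP N B.+2.
  by rewrite big_geq// mulr_ge0 ?tail_ge0// ltW.
case: N => // -[//|N] in NA BN *.
rewrite !ltnS in BN.
have shE (n : nat) : f (x - n.+3%:R) * f (n.+2%:R - 1) = f (x - 3 - n%:R) * f (n%:R + 1).
  have -> : x - n.+3%:R = x - 3 - n%:R by rewrite -addn3 natrD; lra.
  by have -> : n.+2%:R - 1 = n%:R + 1 :> R by rewrite -addn2 natrD; lra.
have -> : \sum_(B.+2 <= n < N.+2) f (x - n.+1%:R) * f (n%:R - 1) =
    \sum_(B <= n < N) f (x - 3 - n%:R) * f (n%:R + 1).
  rewrite 2!big_add1/=; apply: eq_bigr => n _; exact: shE.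
apply: (@le_trans _ _ (e / 2 * f (x - 3))); last first.
  have := hx1 _ xx1; have := tail_ge0 F x; nra.
rewrite -lee_fin; apply: le_trans (hw _ _); last by lra.
apply: le_trans (sum_tail_le_tail_conv _ (ltnW BN)) _.
apply: ge0_subset_integral => //.
- exact: measurable_tail_conv.
- by move=> y _; rewrite lee_fin mulr_ge0// tail_ge0.
- move=> y /=; rewrite !in_itv/= => /andP[-> /ltW yN]/=.
  move: NA; rewrite -(addn2 N) -(addn2 B) !natrD; lra.
Qed.

End SstarSum.

(** * Mixtures of shifted tails *)

Section Mixture.
Context (R : realType) (F : probability R R) (b : R).
Notation f := (tail F).

(** The tail of [GH F H] before truncation at [1]. *)
Definition mix_tail (H : {measure set R -> \bar R}) (x : R) : \bar R :=
  (\int[H]_(t in `[0%R, +oo[) (f (x + t))%:E)%E.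

Lemma measurable_shifted_tail (x : R) (D : set R) : measurable D ->
  measurable_fun D (fun t => (f (x + t))%:E).
Proof.
move=> mD; apply/measurable_EFinP.
apply: (@measurableT_comp _ _ _ _ _ _ f); first exact: measurable_tail.
exact: measurable_funD.
Qed.

Lemma mix_tail_ge0 H x : (0 <= mix_tail H x)%E.
Proof. by apply: integral_ge0 => t _; rewrite lee_fin tail_ge0. Qed.

Lemma class_H_itv (H : {measure set R -> \bar R}) (t : R) : class_H b H ->
  (H `]t, (t + 1)%R]%classic <= b%:E)%E.
Proof.
move=> [_ _]; apply: le_trans.
by apply: ereal_sup_ubound; exists t.
Qed.

(** The unit intervals ]k - 1, k] cover the half-line, including a possible atom at
[0], and each has mass at most [b]. *)
Lemma class_H_integral_le (H : {measure set R -> \bar R}) (u : R -> \bar R)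
    (U : nat -> \bar R) : class_H b H ->
  measurable_fun setT u -> (forall t, 0 <= u t)%E ->
  (forall (k : nat) (t : R), k%:R - 1 < t -> t <= k%:R -> (u t <= U k)%E) ->
  (\int[H]_(t in `[0%R, +oo[) u t <= b%:E * \sum_(0 <= k <oo) U k)%E.
Proof.
move=> Hb mu u0 uU.
have U0 k : (0 <= U k)%E by apply: (le_trans (u0 k%:R)); apply: uU => //; lra.
pose I (n : nat) : set R := `](n%:R - 1)%R, n%:R]%classic.
have tr : trivIset [set: nat] I.
  apply/trivIsetP => i j _ _ ij; apply/seteqP; split => // x /=.
  rewrite /I/= !in_itv/= => -[/andP[ix xi] /andP[jx xj]].
  have := lt_le_trans ix xj; have := lt_le_trans jx xi.
  rewrite !ltrBlDr !natr1 !ltr_nat !ltnS => ji ij'.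
  by move: ij; rewrite eqn_leq ji ij'.
have mI n : measurable (I n) by exact: measurable_itv.
have mU D : measurable D -> measurable_fun D u by move=> mD; exact: measurable_funS mu.
have b0 : (0 <= b)%R by rewrite -lee_fin (le_trans _ (class_H_itv 0 Hb)).
apply: (@le_trans _ _ (\int[H]_(y in \bigcup_n I n) u y)%E).
  apply: ge0_subset_integral => //.
  - exact: bigcup_measurable.
  - by apply: mU; exact: bigcup_measurable.
  - move=> x/=; rewrite in_itv/= andbT => x0.
    exists `|Num.ceil x|%N => //.
    have cx : (0 <= Num.ceil x)%R by rewrite ceil_ge0 (lt_le_trans _ x0)// ltrN10.
    rewrite /I/= in_itv/= natr_absz ger0_norm//.
    by have := ceil_itv x; rewrite intrB.
rewrite ge0_integral_bigcup//=; last by apply: mU; exact: bigcup_measurable.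
rewrite -nneseriesZl//.
apply: lee_nneseries => [n _ _|n _]; first exact: integral_ge0.
apply: (@le_trans _ _ (\int[H]_(x in I n) cst (U n) x)%E).
  apply: ge0_le_integral => //; first exact: mU.
  by move=> x /=; rewrite /I/= in_itv/= => /andP[]; exact: uU.
rewrite integral_cst// muleC lee_wpmul2r//.
by have := class_H_itv (n%:R - 1) Hb; rewrite subrK.
Qed.

Hypothesis FS : class_Sstar F.

Lemma series_tail_le (c : R) :
  (\sum_(0 <= k <oo) (f (c + 1 + k%:R))%:E <= tail_mass F `[c, +oo[)%E.
Proof.
pose I (n : nat) : set R := `[c + n%:R, c + n%:R + 1[%classic.
have tr : trivIset [set: nat] I.
  apply/trivIsetP => i j _ _ ij; apply/seteqP; split => // x /=.
  rewrite /I/= !in_itv/= => -[/andP[ix xi] /andP[jx xj]].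
  have := le_lt_trans ix xj; have := le_lt_trans jx xi.
  rewrite -!addrA !ltrD2l !natr1 !ltr_nat !ltnS => ji ij'.
  by move: ij; rewrite eqn_leq ji ij'.
have mI n : measurable (I n) by exact: measurable_itv.
have <- : \bigcup_n I n = `[c, +oo[%classic.
  apply/seteqP; split => y /=.
    move=> [n _]; rewrite /I/= !in_itv/= andbT => /andP[/(le_trans _)-> //].
    by rewrite lerDl.
  rewrite in_itv/= andbT => y0; exists (Num.truncn (y - c)) => //.
  have := @truncn_itv _ (y - c); rewrite subr_ge0 => /(_ y0)/andP[h1 h2].
  rewrite /I/= in_itv/=; apply/andP; split; first by lra.
  by move: h2; rewrite -natr1; lra.
rewrite /tail_mass ge0_integral_bigcup//; last 2 first.
- by apply: measurable_EFin_tail; exact: bigcup_measurable.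
- by move=> x _; rewrite lee_fin tail_ge0.
apply: lee_nneseries => n _; first by rewrite lee_fin tail_ge0.
have := @tail_mass_itv_le _ F (c + n%:R) (c + n%:R + 1).
rewrite (addrC (c + n%:R)) addrK mul1r [X in f X]addrC (_ : c + n%:R + 1 = c + 1 + n%:R); last by lra.
by rewrite [X in `[_, X[%classic]addrC; apply; lra.
Qed.

(** Summing over unit steps compares [g x] with [b] times the integral of [f]
over [x - 2, +oo[, a quantity that tends to [0] and does not involve [H]. *)
Lemma mix_tail_small (e : R) : 0 < b -> 0 < e ->
  exists x0 : R, forall (H : {measure set R -> \bar R}) x, class_H b H -> x0 <= x -> (mix_tail H x <= e%:E)%E.
Proof.
move=> b0 e0; have eb0 : 0 < e / b by rewrite divr_gt0.
have [N hN] := tail_mass_cvg FS eb0.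
exists (N%:R + 2) => H x Hb Nx.
apply: (@le_trans _ _ (b%:E * \sum_(0 <= k <oo) (f ((x - 2) + 1 + k%:R))%:E)%E).
  apply: class_H_integral_le => //.
  - exact: measurable_shifted_tail.
  - by move=> t; rewrite lee_fin tail_ge0.
  - by move=> k t kt _; rewrite lee_fin; apply: le_tail; lra.
have -> : e%:E = (b%:E * (e / b)%:E)%E by rewrite -EFinM mulrC divfK// gt_eqF.
apply: lee_wpmul2l; first by rewrite lee_fin ltW.
apply: le_trans (series_tail_le _) _.
have Nx2 : N%:R <= x - 2 by lra.
have := hN _ Nx2.
have x20 : 0 <= x - 2 by apply: le_trans Nx2.
have : (tail_mass F `[0%R, (x - 2)%R[ + tail_mass F `[(x - 2)%R, +oo[ = (fine (mean F))%:E)%E.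
  rewrite -tail_mass_setU//; last first.
    by apply/disj_setPS => y [] /=; rewrite !in_itv/= => /andP[_ /lt_le_trans h] /andP[/h]; rewrite ltxx.
  by rewrite -itv_bndbnd_setU// mean_fineK// meanE.
have := tail_mass_ge0 F `[0%R, (x - 2)%R[.
have := tail_mass_ge0 F `[(x - 2)%R, +oo[.
move: (tail_mass F `[0%R, (x - 2)%R[%classic) (tail_mass F `[(x - 2)%R, +oo[%classic).
move=> [M1||] [M2||] //; rewrite -!EFinD !lee_fin => ? ? [] ?; lra.
Qed.

(** For [t] in ]k - 1, k] the increment of [f] over [x + t, x + t + 1] is at most
that over [x - 1 + k, x - 1 + k + 2]. These windows of length [2] overlap twice, and
their increments telescope to at most [f (x - 1) + f x]. *)
Lemma mix_tail_increment (H : {measure set R -> \bar R}) x : class_H b H ->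
  (mix_tail H x <= mix_tail H (x + 1)%R + (2 * b * f (x - 1))%:E)%E.
Proof.
move=> Hb.
have b0 : (0 <= b)%R by rewrite -lee_fin (le_trans _ (class_H_itv 0 Hb)).
pose u t := (f (x + t) - f (x + 1 + t))%:E.
have u0 t : (0 <= u t)%E.
  by rewrite lee_fin subr_ge0; apply: le_tail; lra.
have mu : measurable_fun setT u.
  apply/measurable_EFinP/measurable_funB; apply/measurable_EFinP; exact: measurable_shifted_tail.
have -> : mix_tail H x = (mix_tail H (x + 1)%R + \int[H]_(t in `[0%R, +oo[) u t)%E.
  rewrite /mix_tail -ge0_integralD//.
  - by apply: eq_integral => t _; rewrite /u -EFinD; congr (_%:E); lra.
  - by move=> t _; rewrite lee_fin tail_ge0.
  - exact: measurable_shifted_tail.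
  - exact: measurable_funS mu.
rewrite leeD2l//.
pose U (k : nat) := f (x - 1 + k%:R) - f (x - 1 + k.+2%:R).
have U0 k : 0 <= U k.
  by rewrite subr_ge0; apply: le_tail; rewrite lerD2l ler_nat (@leq_addl 2).
apply: (@le_trans _ _ (b%:E * \sum_(0 <= k <oo) (U k)%:E)%E).
  apply: class_H_integral_le => //.
  move=> k t kt tk; rewrite lee_fin /U lerB//; apply: le_tail; first lra.
  by rewrite -addn2 natrD; lra.
rewrite mulrAC mulrC EFinM lee_wpmul2l ?lee_fin//.
apply: lime_le.
  by apply: is_cvg_nneseries => k _ _; rewrite lee_fin.
apply: nearW => n; rewrite sumEFin lee_fin.
have -> : \sum_(0 <= k < n) U k = f (x - 1) + f (x - 1 + 1) - f (x - 1 + n%:R) - f (x - 1 + n.+1%:R).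
  elim: n => [|n IH]; first by rewrite big_geq//= addr0; lra.
  by rewrite big_nat_recr//= IH /U; lra.
have := tail_ge0 F (x - 1 + n%:R); have := tail_ge0 F (x - 1 + n.+1%:R).
have : f (x - 1 + 1) <= f (x - 1) by apply: le_tail; lra.
lra.
Qed.

Lemma mix_tail_shift (H : {measure set R -> \bar R}) (a e x : R) : 0 <= 1 + e ->
  (forall y, x <= y -> f (y - a) <= (1 + e) * f y) ->
  (mix_tail H (x - a)%R <= (1 + e)%:E * mix_tail H x)%E.
Proof.
move=> e0 h; rewrite /mix_tail -ge0_integralZl_EFin//.
- apply: ge0_le_integral => //.
  + by move=> t _; rewrite lee_fin tail_ge0.
  + exact: measurable_shifted_tail.
  + by apply: measurable_funeM; exact: measurable_shifted_tail.
  + move=> t; rewrite /= in_itv/= andbT => t0.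
    rewrite -EFinM lee_fin addrAC; apply: h; lra.
- by move=> t _; rewrite lee_fin tail_ge0.
- exact: measurable_shifted_tail.
Qed.

(** A vanishing integral of a positive function would make [H] the zero measure. *)
Lemma mix_tail_gt0 (H : {measure set R -> \bar R}) (x : R) : class_H b H ->
  (0 < mix_tail H x)%E.
Proof.
move=> [H0 HT _]; rewrite lt_neqAle mix_tail_ge0 andbT eq_sym.
apply: contra HT => /eqP g0.
have : (\int[H]_(t in `[0%R, +oo[) `|(f (x + t))%:E| = 0)%E.
  rewrite -[RHS]g0; apply: eq_integral => t _.
  by rewrite gee0_abs// lee_fin tail_ge0.
move/ae_eq_integral_abs => /(_ (measurable_itv _) (measurable_shifted_tail _ (measurable_itv _))).
move=> [N [mN N0 sN]].
rewrite -measure_le0.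
have := @measureU2 _ _ _ H `]-oo, 0[ (~` `]-oo, 0[).
rewrite setUv => /(_ _ _)/le_trans; apply => //; first exact: measurableC.
rewrite [X in (X + _)%E](_ : _ = 0%E) ?add0e//.
rewrite setCitvl -N0 le_measure ?inE// => t tI.
apply: sN => /= /(_ tI); have := tail_gt0 FS (x + t).
by move=> + [] h; rewrite h ltxx.
Qed.

Lemma mix_sum_le (H : {measure set R -> \bar R}) (e x : R) (A N : nat) : 0 <= e ->
  (forall y, x <= y ->
    \sum_(A <= n < N) f (y - n.+1%:R) * f (n%:R - 1) <= e * f y) ->
  (\sum_(A <= n < N) (f (n%:R - 1))%:E * mix_tail H (x - n.+1%:R)%R <= e%:E * mix_tail H x)%E.
Proof.
move=> e0 h.
under eq_bigr => n _.
  rewrite /mix_tail -ge0_integralZl_EFin//; last 3 first.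
  - by move=> t _; rewrite lee_fin tail_ge0.
  - exact: measurable_shifted_tail.
  - exact: tail_ge0.
  over.
rewrite -ge0_integral_sum//; last 2 first.
- by move=> n; apply: measurable_funeM; exact: measurable_shifted_tail.
- by move=> n t _; rewrite mule_ge0// lee_fin tail_ge0.
rewrite /mix_tail -ge0_integralZl_EFin//; last 2 first.
- by move=> t _; rewrite lee_fin tail_ge0.
- exact: measurable_shifted_tail.
apply: ge0_le_integral => //.
- by move=> t _; apply: sume_ge0 => n _; rewrite mule_ge0// lee_fin tail_ge0.
- by apply: emeasurable_sum => n; apply: measurable_funeM; exact: measurable_shifted_tail.
- by apply: measurable_funeM; exact: measurable_shifted_tail.
- move=> t; rewrite /= in_itv/= andbT => t0.
  under eq_bigr do rewrite -EFinM.
  rewrite sumEFin -EFinM lee_fin.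
  have xt : x <= x + t by lra.
  apply: le_trans (h _ xt).
  by under eq_bigr do rewrite mulrC addrAC.
Qed.

End Mixture.

(** * Tails of convolutions *)

Section Convolution.
Context (R : realType) (G : probability R R).
Notation T := (tail G).

Definition sum_above (x : R) : set (R * R) := [set p | x < p.1 + p.2].

Lemma sum_aboveE (x : R) :
  sum_above x = (fun p : R * R => p.1 + p.2) @^-1` `]x, +oo[%classic.
Proof. by apply/seteqP; split => p /=; rewrite in_itv/= andbT. Qed.

Lemma measurable_sum_above x : measurable (sum_above x).
Proof.
rewrite sum_aboveE -[X in measurable X]setTI.
exact: measurable_funD.
Qed.

(** [P] stands for the product measure, known by its values on rectangles. *)
Section Product.
Variable P : {measure set (R * R) -> \bar R}.
Hypothesis PX : forall A B : set R, measurable A -> measurable B ->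
  P (A `*` B) = (G A * G B)%E.

Let PU (A B : set (R * R)) : measurable A -> measurable B ->
  A `&` B = set0 -> P (A `|` B) = (P A + P B)%E.
Proof. by move=> mA mB AB; rewrite measureU. Qed.

Let PU_le (A B : set (R * R)) : measurable A -> measurable B ->
  (P (A `|` B) <= P A + P B)%E.
Proof. exact: measureU2. Qed.

(** For non-negative variables the sum exceeds [x] as soon as the maximum does. *)
Lemma product_sum_above_ge (x : R) : on_nonneg G -> 0 <= x ->
  ((2 * T x - T x ^+ 2)%:E <= P (sum_above x))%E.
Proof.
move=> G0 x0; have mx := measurable_sum_above x.
have GT : G `[0, +oo[%classic = 1%E.
  by rewrite -setCitvl probability_setC// G0 sube0.
have Gx : G `[0, x]%classic = (1 - T x)%:E.
  rewrite EFinB -tailE -GT.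
  have -> : `[0, +oo[%classic = `[0, x]%classic `|` `]x, +oo[%classic :> set R.
    by rewrite -itv_bndbnd_setU.
  rewrite measureU//; last first.
    by apply/seteqP; split => z //= []; rewrite !in_itv/= andbT => /andP[_ /le_lt_trans h /h]; rewrite ltxx.
  by rewrite addeK// fin_num_measure.
apply: (@le_trans _ _ (P ((`]x, +oo[ `*` `[0, +oo[) `|` (`[0, x] `*` `]x, +oo[)))).
  rewrite PU; [|exact: measurableX|exact: measurableX|]; last first.
    apply/seteqP; split => p //= [[+ _] [+ _]]; rewrite !in_itv/= andbT => h /andP[_ h'].
    by have := lt_le_trans h h'; rewrite ltxx.
  rewrite !PX// GT mule1 Gx tailE -EFinM -EFinD lee_fin; lra.
apply: le_measure; rewrite ?inE//.
  by apply: measurableU; exact: measurableX.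
by move=> p /= [[]|[]]; rewrite /sum_above !in_itv/= ?andbT => h1 h2; lra.
Qed.

(** If one coordinate is at most [A], the other exceeds [x - A]: this gives the first
term. Otherwise the first coordinate exceeds [N], or lies in a cell ]n, n + 1]
with [A <= n < N] and then the second exceeds [x - n - 1]. *)
Lemma product_sum_above_le (x : R) (A N : nat) : (A <= N)%N ->
  (P (sum_above x) <= (2 * T (x - A%:R) + T N%:R * T A%:R +
    \sum_(A <= n < N) (T n%:R - T n.+1%:R) * T (x - n.+1%:R))%:E)%E.
Proof.
move=> AN; have mx := measurable_sum_above x.
pose S k := sum_above x `&` (`]A%:R, k%:R]%classic `*` setT).
have mS k : measurable (S k) by apply: measurableI => //; exact: measurableX.
have PS : (P (S N) <= (\sum_(A <= n < N) (T n%:R - T n.+1%:R) * T (x - n.+1%:R))%:E)%E.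
  rewrite -(subnKC AN); elim: (N - A)%N => [|k IH].
    rewrite addn0 big_geq// (_ : S A = set0) ?measure0//.
    by apply/seteqP; split => p // [_ [/=]]; rewrite in_itv/= => /andP[/lt_le_trans h /h]; rewrite ltxx.
  rewrite addnS big_nat_recr ?leq_addr//= EFinD.
  set n := (A + k)%N in IH *.
  apply: (@le_trans _ _ (P (S n `|` (`]n%:R, n.+1%:R] `*` `](x - n.+1%:R)%R, +oo[)))).
    apply: le_measure; rewrite ?inE//.
      by apply: measurableU => //; exact: measurableX.
    move=> p [/= xp [/=]]; rewrite in_itv/= => /andP[Ap pn] _.
    have [pn'|np] := leP p.1 n%:R.
      by left; split => //; split => //=; rewrite in_itv/= Ap.
    by right; split => /=; rewrite in_itv/= ?np ?andbT//; move: xp; rewrite /sum_above/=; lra.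
  apply: le_trans (PU_le _ _) _ => //; first exact: measurableX.
  rewrite leeD// PX// EFinM tail_itvoc ?ler_nat// tailE//.
apply: (@le_trans _ _ (P (((setT `*` `](x - A%:R)%R, +oo[) `|` (`](x - A%:R)%R, +oo[ `*` setT))
     `|` (`]N%:R, +oo[ `*` `]A%:R, +oo[) `|` S N))).
  apply: le_measure; rewrite ?inE//.
    by repeat apply: measurableU => //; exact: measurableX.
  move=> p xp; move: (xp); rewrite /sum_above/= => xp'.
  have [p1|p1] := leP p.1 A%:R.
    by left; left; left; split => //=; rewrite in_itv/= andbT; lra.
  have [p2|p2] := leP p.2 A%:R.
    by left; left; right; split => //=; rewrite in_itv/= andbT; lra.
  have [p3|p3] := leP p.1 N%:R.
    by right; split => //; split => //=; rewrite in_itv/= p1.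
  by left; right; split => /=; rewrite in_itv/= andbT.
have PT : G setT = 1%E by exact: probability_setT.
apply: le_trans (PU_le _ _) _ => //.
  by repeat apply: measurableU => //; exact: measurableX.
rewrite EFinD leeD//.
apply: le_trans (PU_le _ _) _ => //; [|exact: measurableX|].
  by apply: measurableU => //; exact: measurableX.
rewrite EFinD leeD//; last by rewrite PX// !tailE EFinM.
apply: le_trans (PU_le _ _) _ => //; [exact: measurableX|exact: measurableX|].
by rewrite !PX// PT mul1e mule1 !tailE -EFinD lee_fin; lra.
Qed.

End Product.

Let PX (A B : set R) : measurable A -> measurable B ->
  (G \x G)%E (A `*` B) = (G A * G B)%E.
Proof. by move=> mA mB; exact: product_measure1E. Qed.

Lemma tail_convolutionE (x : R) :
  (tail (convolution G G) x)%:E = (G \x G)%E (sum_above x).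
Proof.
rewrite /tail /convolution /pushforward -sum_aboveE fineK//.
rewrite ge0_fin_numE ?measure_ge0//.
apply: (@le_lt_trans _ _ ((G \x G)%E setT)).
  by apply: le_measure; rewrite ?inE//; exact: measurable_sum_above.
have GT : G setT = 1%E by exact: probability_setT.
by rewrite -setXTT PX// GT mule1 ltry.
Qed.

Lemma tail_convolution_ge (x : R) : on_nonneg G -> 0 <= x ->
  2 * T x - T x ^+ 2 <= tail (convolution G G) x.
Proof.
move=> G0 x0; rewrite -lee_fin tail_convolutionE.
exact: product_sum_above_ge.
Qed.

Lemma tail_convolution_le (x : R) (A N : nat) : (A <= N)%N ->
  tail (convolution G G) x <= 2 * T (x - A%:R) + T N%:R * T A%:R +
    \sum_(A <= n < N) (T n%:R - T n.+1%:R) * T (x - n.+1%:R).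
Proof.
move=> AN; rewrite -lee_fin tail_convolutionE.
exact: product_sum_above_le.
Qed.

(** The tail tends to [0], so it drops below its value at any given [c]. The last
point [sup S] up to which the tail keeps its value at [c] belongs to the support:
a null ball around it would prolong the plateau. *)
Lemma unbounded_support : (forall x, 0 < T x) -> ~ bounded_set (support_of G).
Proof.
move=> T0 [M0 [_ hM]].
pose M := Num.max 0 (M0 + 1).
have hMs y : support_of G y -> y <= M.
  move=> Gy; apply: (le_trans (ler_norm y)).
  by apply: (hM M) => //; rewrite /M lt_max; apply/orP; right; lra.
pose c := M + 1.
pose S := [set y | c <= y /\ T y = T c].
have Sc : S c by [].
have [y0 cy0 Ty0] : exists2 y, c <= y & T y < T c.
  have : T x @[x --> +oo] --> 0.
    have mid : measurable_fun [set: R] (idfun : R -> R) by exact: measurable_id.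
    pose X : {RV G >-> R} := HB.pack (idfun : R -> R) (isMeasurableFun.Build _ _ _ _ _ mid).
    have := cvg_ccdfy0 X.
    by move=> /fine_cvgP[_].
  move=> /cvgrPdist_lt/(_ _ (T0 c))[K [_ hK]].
  exists (Num.max c (K + 1)); first by rewrite le_max lexx.
  have /hK/= : K < Num.max c (K + 1) by rewrite lt_max; apply/orP; right; lra.
  by rewrite sub0r normrN ger0_norm// tail_ge0.
have Sub : has_ubound S.
  exists y0 => y [_ yE]; rewrite leNgt; apply/negP => /ltW/(le_tail G).
  by rewrite yE leNgt Ty0.
have supS : has_sup S by split => //; exists c.
have cs : c <= sup S by exact: ub_le_sup.
have : ~ support_of G (sup S).
  by move=> /hMs; rewrite /c in cs *; lra.
apply => e e0; rewrite lt_neqAle measure_ge0 andbT; apply/negP => /eqP Ge.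
have [y Sy ey] := sup_adherent e0 supS.
have ys : y <= sup S by exact: ub_le_sup.
have yz : y <= sup S + e / 2 by lra.
have : (G `]y, (sup S + e / 2)%R]%classic <= G (ball (sup S) e))%E.
  apply: le_measure; rewrite ?inE//; first exact: measurable_ball.
  move=> z /=; rewrite in_itv/= /ball/= => /andP[? ?].
  rewrite ltr_distlC; apply/andP; split; lra.
rewrite -Ge tail_itvoc// lee_fin subr_le0 => Tyz.
have : S (sup S + e / 2).
  have [cy Ty] := Sy; split; first lra.
  by rewrite -Ty; apply/eqP; rewrite eq_le Tyz le_tail.
by move=> /(ub_le_sup Sub); lra.
Qed.

End Convolution.

(** * Uniform subexponentiality *)

Section Uniform.
Context (R : realType) (F : probability R R) (b : R).
Hypothesis FS : class_Sstar F.
Hypothesis b0 : 0 < b.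
Notation f := (tail F).
Notation conv H := (convolution (GH F H) (GH F H)).

Lemma GH_tailE (H : {measure set R -> \bar R}) (x : R) : class_H b H -> 0 <= x ->
  (tail (GH F H) x)%:E = mine 1%E (mix_tail F H x).
Proof.
move=> Hb x0; have [_ /(_ x x0)] := GHP FS Hb; rewrite tailE => ->.
by congr (mine _ _); apply: eq_integral => t _; rewrite tailE.
Qed.

Lemma GH_tail_gt0 (H : {measure set R -> \bar R}) (x : R) : class_H b H ->
  0 < tail (GH F H) x.
Proof.
move=> Hb; apply: (@lt_le_trans _ _ (tail (GH F H) (Num.max 0 x))).
  rewrite -lte_fin GH_tailE// ?le_max ?lexx//.
  by rewrite lt_min lte01/=; exact: (mix_tail_gt0 FS _ Hb).
by apply: le_tail; rewrite le_max lexx orbT.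
Qed.

(** All thresholds are chosen from [F], [b] and [e] before [H] is given. *)
Lemma uniform_subexponential (e : R) : 0 < e ->
  exists x0 : R, forall (H : {measure set R -> \bar R}) x, class_H b H -> x0 <= x ->
    `|tail (conv H) x / tail (GH F H) x - 2| <= e.
Proof.
move=> e0; have b_gt0 := b0.
(* The errors below add up to at most [(2 + d) * (1 + d) - 2 + 2 * b * d], hence to
   at most [d * c] when [d <= 1]. *)
pose c := 4 + 2 * b.
have c0 : 0 < c by rewrite /c; lra.
pose d := Num.min 1 (e / c).
have d0 : 0 < d by rewrite lt_min ltr01 divr_gt0.
have d1 : d <= 1 by rewrite ge_min lexx.
have dc : d * c <= e by rewrite -ler_pdivlMr// ge_min lexx orbT.
have [x1 small] := mix_tail_small FS b0 d0.
have [A x1A [x2 mid]] := sum_tail_middle FS (Num.truncn x1).+1 d0.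
have {x1A} x1A : x1 <= A%:R.
  by apply: (le_trans (ltW (truncnS_gt x1))); rewrite ler_nat.
(* [A.+1] because rounding [N] down to an integer costs one more unit. *)
have [x3 shift] := tail_shift FS (ler0n R A.+1) d0.
exists (Num.max (Num.max x2 x3) (A%:R + A%:R + 1)) => H x Hb.
rewrite !ge_max => /andP[/andP[x2x x3x] Ax].
have A0 : 0 <= A%:R :> R by [].
set T := tail (GH F H).
have T0 y : 0 < T y by exact: GH_tail_gt0.
(* From [A] on, the truncation at [1] is inactive. *)
have gT y : A%:R <= y -> mix_tail F H y = (T y)%:E.
  move=> Ay; rewrite /T GH_tailE//; last exact: le_trans Ay.
  rewrite min_r//; apply: le_trans (small _ _ Hb _) _; first exact: le_trans Ay.
  by rewrite lee_fin.
have Td y : A%:R <= y -> T y <= d.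
  by move=> Ay; rewrite -lee_fin -gT//; apply: small => //; exact: le_trans Ay.
pose N := Num.truncn (x - A%:R).
have /andP[Nle Ngt] : N%:R <= x - A%:R < N.+1%:R by apply: truncn_itv; lra.
have AN : (A <= N)%N.
  by rewrite -ltnS -(ltr_nat R); apply: le_lt_trans Ngt; lra.
have lower : 2 * T x - T x ^+ 2 <= tail (conv H) x.
  by apply: tail_convolution_ge; [case: (GHP FS Hb)|lra].
have sumT : \sum_(A <= n < N) (T n%:R - T n.+1%:R) * T (x - n.+1%:R) <= 2 * b * d * T x.
  have : (\sum_(A <= n < N) (f (n%:R - 1))%:E * mix_tail F H (x - n.+1%:R)%R
      <= d%:E * mix_tail F H x)%E.
    apply: mix_sum_le; first exact: ltW.
    by move=> y xy; apply: mid; [lra|apply: (le_trans Nle); lra].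
  rewrite gT; last by lra.
  move=> S; rewrite -mulrA -lee_fin EFinM [in leRHS]EFinM.
  apply: le_trans (lee_wpmul2l _ S); last by rewrite lee_fin; lra.
  rewrite ge0_sume_distrr; last first.
    by move=> n _; rewrite mule_ge0 ?mix_tail_ge0// lee_fin tail_ge0.
  rewrite -sumEFin; rewrite !big_nat; apply: lee_sum => n /andP[An nN].
  have An' : A%:R <= n%:R :> R by rewrite ler_nat.
  have nN' : n.+1%:R <= N%:R :> R by rewrite ler_nat.
  rewrite gT; last by lra.
  rewrite -!EFinM lee_fin mulrA ler_wpM2r ?(ltW (T0 _))//.
  have := mix_tail_increment F n%:R Hb.
  rewrite natr1 !gT ?ler_nat ?(leqW An)// -EFinD lee_fin; lra.
have upper := @tail_convolution_le _ (GH F H) x A N AN.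
rewrite -/T in upper.
have TN : T N%:R <= T (x - A.+1%:R).
  by apply: le_tail; move: Ngt; rewrite -!natr1; lra.
have TA : T (x - A%:R) <= T (x - A.+1%:R).
  by apply: le_tail; rewrite -natr1; lra.
have Tshift : T (x - A.+1%:R) <= (1 + d) * T x.
  rewrite -lee_fin EFinM -!gT; last 2 first.
  - lra.
  - by rewrite -natr1; lra.
  apply: mix_tail_shift; first lra.
  by move=> y xy; apply: shift; lra.
have Tx0 := T0 x.
rewrite ler_distl; apply/andP; split.
  rewrite ler_pdivlMr//.
  have : T x <= d by apply: Td; lra.
  rewrite expr2 in lower.
  have : d <= e by apply: le_trans dc; rewrite ler_peMr// ?ltW// /c; lra.
  nra.
rewrite ler_pdivrMr//; apply: (le_trans upper).
have TAd : T A%:R <= d by exact: Td.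
have TAd' : T N%:R * T A%:R <= d * T (x - A.+1%:R).
  by rewrite mulrC; apply: ler_pM => //; exact: ltW.
have B1 : (2 + d) * T (x - A.+1%:R) <= (2 + d) * ((1 + d) * T x).
  by rewrite ler_wpM2l//; lra.
have B2 : (2 + d) * (1 + d) <= 2 + 4 * d by nra.
have B3 : (2 + d) * (1 + d) * T x <= (2 + 4 * d) * T x by rewrite ler_wpM2r// ltW.
have B4 : d * c * T x <= e * T x by rewrite ler_wpM2r// ltW.
rewrite /c in B4; nra.
Qed.

Lemma GH_subexponential (H : {measure set R -> \bar R}) : class_H b H ->
  subexponential (GH F H).
Proof.
move=> Hb; split.
- by case: (GHP FS Hb).
- by apply: unbounded_support => x; exact: GH_tail_gt0.
- apply/cvgrPdist_le => e e0.
  have [x0 hx0] := uniform_subexponential e0.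
  near=> x.
  have /(hx0 _ _ Hb) : x0 <= x by near: x; apply: nbhs_pinfty_ge; rewrite num_real.
  have Tx := GH_tail_gt0 x Hb.
  have -> : tail (conv H) x / (2 * tail (GH F H) x) = (tail (conv H) x / tail (GH F H) x) / 2.
    by rewrite invfM mulrA mulrAC.
  move: (_ / tail _ _) => r; rewrite !ler_distlC => /andP[? ?]; apply/andP; split; lra.
Unshelve. all: by end_near. Qed.

(** The point mass [b] at [0] belongs to the class. The supremum over the empty set
would be [-oo], so the convergence to [0] depends on this. *)
Lemma class_H_nonempty : exists H : {measure set R -> \bar R}, class_H b H.
Proof.
pose H : {measure set R -> \bar R} := mscale (NngNum (ltW b0)) \d_(0 : R).
have HE A : H A = (b%:E * \d_(0%R : R) A)%E by [].
exists H; split.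
- by rewrite /on_nonneg HE diracE memNset ?mule0//= in_itv/= ltxx.
- by rewrite HE diracT mule1 eqe gt_eqF.
- apply: ge_ereal_sup => _ [t _ <-]; rewrite HE diracE.
  by case: (_ \in _); rewrite ?mule1 ?mule0 ?lee_fin ?(ltW b0).
Qed.

End Uniform.

Theorem lemma9 (R : realType) (F : probability R R) (b : R) :
  class_Sstar F -> 0 < b ->
  (forall H : {measure set R -> \bar R}, class_H b H ->
     subexponential (GH F H)) /\
  ereal_sup [set (`| tail (convolution (GH F H) (GH F H)) x
                     / tail (GH F H) x - 2 |)%:E | H in class_H b]
    @[x --> +oo] --> 0%E.
Proof.
move=> FS b0; split; first exact: GH_subexponential.
have [H0 H0b] := class_H_nonempty b0.
pose D x (H : {measure set R -> \bar R}) :=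
  `|tail (convolution (GH F H) (GH F H)) x / tail (GH F H) x - 2|.
have lb x : (0 <= ereal_sup [set (D x H)%:E | H in class_H b])%E.
  apply: (@le_trans _ _ (D x H0)%:E); first by rewrite lee_fin normr_ge0.
  by apply: ereal_sup_ubound; exists H0.
have ub e : 0 < e -> exists x0 : R, forall x, x0 <= x ->
    (ereal_sup [set (D x H)%:E | H in class_H b] <= e%:E)%E.
  move=> e0; have [x0 hx0] := uniform_subexponential FS b0 e0.
  exists x0 => x x0x; apply: ge_ereal_sup => _ [H Hb <-].
  by rewrite lee_fin; exact: hx0.
apply/fine_cvgP; split.
  have [x0 hx0] := ub _ ltr01.
  near=> x; rewrite ge0_fin_numE; last exact: lb.
  apply: le_lt_trans (ltry 1); apply: hx0.
  by near: x; apply: nbhs_pinfty_ge; rewrite num_real.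
apply/cvgrPdist_le => e e0; have [x0 hx0] := ub _ e0.
near=> x; rewrite sub0r normrN ger0_norm; last by apply: fine_ge0; exact: lb.
have h : (ereal_sup [set (D x H)%:E | H in class_H b] <= e%:E)%E.
  by apply: hx0; near: x; apply: nbhs_pinfty_ge; rewrite num_real.
rewrite -lee_fin fineK// ge0_fin_numE; last exact: lb.
exact: le_lt_trans h (ltry _).
Unshelve. all: by end_near. Qed.
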